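(* Assume that $\operatorname{char} \Bbbk = 0$. Any automorphism of $\mathcal{B}$ belonging to $N = \{\sigma_{s,1} : s \in \Bbbk[z]\}$ is the exponential of a locally nilpotent derivation of $\mathcal{B}$.
   Context: Let $\Bbbk$ be a field. The super Jordan plane $\mathcal{B}$ is the associative unital $\Bbbk$-algebra presented by generators $x, y$ with defining relations $x^2 = 0$ and $yz - zy - xz = 0$, where $z = xy + yx$. The subalgebra generated by $z$ is a polynomial algebra $\Bbbk[z]$. For $s = s(z) \in \Bbbk[z]$, $\sigma_{s,1}$ denotes the unique algebra automorphism of $\mathcal{B}$ such that $\sigma_{s,1}(x) = x$ and $\sigma_{s,1}(y) = y + s(z)x$. Derivations of $\mathcal{B}$ are $\Bbbk$-linear; a derivation $\partial$ is locally nilpotent if for each $b \in \mathcal{B}$ there is $n \geq 1$ with $\partial^n(b) = 0$, and then its exponential is $\exp(\partial) = \sum_{n \geq 0} \frac{1}{n!}\partial^n$. *)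

(* Defs.v *)
From HB Require Import structures.
From mathcomp Require Import all_boot all_order all_algebra.
From mathcomp Require Import boolp finmap.
From mathcomp Require Import monalg.

Set Implicit Arguments.
Unset Strict Implicit.
Unset Printing Implicit Defensive.

Import GRing.Theory.

Local Open Scope ring_scope.
Local Open Scope quotient_scope.

(* k<X, Y> is the monoid algebra of the free monoid on two letters: X is the  *)
(* letter [false], Y the letter [true].                                       *)
Section FreeAlgebra.
Variable k : fieldType.

Definition free_alg : Type := {malg k[{fmonom bool}]}.

HB.instance Definition _ := GRing.Lalgebra.on free_alg.

Fact free_scaleAr (c : k) (u v : {malg k[{fmonom bool}]}) :
  c *: (u * v) = u * (c *: v).
Proof.
apply/malgP => m; rewrite mcoeffZ.
rewrite (malgMEw (fsubset_refl _) (msuppZ_le c v)) malgME.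
rewrite [X in _ * X](raddf_sum (mcoeff m)) [RHS](raddf_sum (mcoeff m)) mulr_sumr.
apply: eq_bigr => i _.
rewrite [X in _ * X](raddf_sum (mcoeff m)) [RHS](raddf_sum (mcoeff m)) mulr_sumr.
apply: eq_bigr => j _.
by rewrite /= [X in _ * X]mcoeffU [RHS]mcoeffU mcoeffZ mulrnAr mulrCA.
Qed.

HB.instance Definition _ := GRing.Lalgebra_isAlgebra.Build k free_alg free_scaleAr.

(* The lock (here and below) only keeps unification from unfolding the        *)
(* constructions.                                                             *)
Fact sjp_key : unit. Proof. exact: tt. Qed.

Definition fgen : bool -> free_alg := locked_with sjp_key (fun i => << fmu i >>).
Definition fX : free_alg := fgen false.
Definition fY : free_alg := fgen true.

Lemma fgenE i : fgen i = << fmu i >>.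
Proof. by rewrite /fgen unlock. Qed.

End FreeAlgebra.

Definition rel1 (A : nzRingType) (x y : A) : A := x * x.
Definition rel2 (A : nzRingType) (x y : A) : A :=
  let z := x * y + y * x in y * z - z * y - x * z.

Lemma rmorph_rel1 (A C : nzRingType) (f : {rmorphism A -> C}) x y :
  f (rel1 x y) = rel1 (f x) (f y).
Proof. exact: rmorphM. Qed.

Lemma rmorph_rel2 (A C : nzRingType) (f : {rmorphism A -> C}) x y :
  f (rel2 x y) = rel2 (f x) (f y).
Proof. by rewrite /rel2 !(rmorphB, rmorphD, rmorphM). Qed.

Section SuperJordanPlane.
Variable k : fieldType.
Local Notation F := (free_alg k).

Inductive jordan_ideal : F -> Prop :=
| JI_rel1 : jordan_ideal (rel1 (fX k) (fY k))
| JI_rel2 : jordan_ideal (rel2 (fX k) (fY k))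
| JI_0 : jordan_ideal 0
| JI_B u v : jordan_ideal u -> jordan_ideal v -> jordan_ideal (u - v)
| JI_Ml a u : jordan_ideal u -> jordan_ideal (a * u)
| JI_Mr u a : jordan_ideal u -> jordan_ideal (u * a).

Definition jideal : {pred F} := fun u => `[< jordan_ideal u >].

Lemma jidealP (u : F) : reflect (jordan_ideal u) (u \in jideal).
Proof. exact: asboolP. Qed.

Fact jideal_zmod_closed : zmod_closed jideal.
Proof.
split; first by apply/jidealP; exact: JI_0.
by move=> u v /jidealP Ju /jidealP Jv; apply/jidealP; exact: JI_B.
Qed.

HB.instance Definition _ := GRing.isZmodClosed.Build F jideal jideal_zmod_closed.

Definition super_jordan_plane : Type := Quotient.quot jideal.
Local Notation B := super_jordan_plane.

HB.instance Definition _ := GRing.Zmodule.on B.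
HB.instance Definition _ := EqQuotient.on B.

Definition sjp_pi : F -> B := locked_with sjp_key (fun u => \pi_B u).
Local Notation pi := sjp_pi.

Lemma pi_eq (u v : F) : (pi u = pi v) <-> jordan_ideal (u - v).
Proof.
rewrite /pi unlock (rwP (jidealP _)) -[_ \in _]/(Quotient.equiv jideal u v).
by rewrite (rwP eqP) piE.
Qed.

Fact pi_zmod_morphism : zmod_morphism pi.
Proof.
by rewrite /pi unlock; exact: (@pi_is_zmod_morphism F _ 0 (Quotient.quot jideal)).
Qed.
HB.instance Definition _ := GRing.isZmodMorphism.Build F B pi pi_zmod_morphism.

Definition sjp_one : B := pi 1.
Definition sjp_mul : B -> B -> B :=
  locked_with sjp_key (fun a b => pi (repr a * repr b)).
Definition sjp_scale : k -> B -> B :=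
  locked_with sjp_key (fun c a => pi (c *: repr a)).

Fact piK (a : B) : pi (repr a) = a.
Proof. by rewrite /pi unlock; exact: reprK. Qed.

Fact pi_mul u v : sjp_mul (pi u) (pi v) = pi (u * v).
Proof.
rewrite /sjp_mul unlock; apply/pi_eq; set u' := repr _; set v' := repr _.
have Ju : jordan_ideal (u' - u) by apply/pi_eq; exact: piK.
have Jv : jordan_ideal (v - v') by apply/pi_eq; rewrite /v' piK.
have -> : u' * v' - u * v = (u' - u) * v' - u * (v - v').
  by rewrite mulrBl mulrBr opprB addrA subrK.
by apply: JI_B; [exact: JI_Mr | exact: JI_Ml].
Qed.

Fact pi_scale c u : sjp_scale c (pi u) = pi (c *: u).
Proof.
rewrite /sjp_scale unlock; apply/pi_eq; rewrite -scalerBr -mulr_algl; apply: JI_Ml.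
by apply/pi_eq; exact: piK.
Qed.

Fact sjp_mulA : associative sjp_mul.
Proof. by move=> a b c; rewrite -[a]piK -[b]piK -[c]piK !pi_mul mulrA. Qed.

Fact sjp_mul1 : left_id sjp_one sjp_mul.
Proof. by move=> a; rewrite -[a]piK pi_mul mul1r. Qed.

Fact sjp_mulr1 : right_id sjp_one sjp_mul.
Proof. by move=> a; rewrite -[a]piK pi_mul mulr1. Qed.

Fact sjp_mulDl : left_distributive sjp_mul +%R.
Proof.
move=> a b c; rewrite -[a]piK -[b]piK -[c]piK.
by rewrite -raddfD !pi_mul -raddfD mulrDl.
Qed.

Fact sjp_mulDr : right_distributive sjp_mul +%R.
Proof.
move=> a b c; rewrite -[a]piK -[b]piK -[c]piK.
by rewrite -raddfD !pi_mul -raddfD mulrDr.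
Qed.

Lemma jordan_ideal_ker (A : nzRingType) (f : {rmorphism F -> A}) u :
    rel1 (f (fX k)) (f (fY k)) = 0 -> rel2 (f (fX k)) (f (fY k)) = 0 ->
  jordan_ideal u -> f u = 0.
Proof.
move=> r1 r2; elim=> {u}.
- by rewrite rmorph_rel1.
- by rewrite rmorph_rel2.
- exact: rmorph0.
- by move=> v w _ v0 _ w0; rewrite rmorphB v0 w0 subr0.
- by move=> a v _ v0; rewrite rmorphM v0 mulr0.
- by move=> v a _ v0; rewrite rmorphM v0 mul0r.
Qed.

Lemma jordan_ideal_coef1 (u : F) : jordan_ideal u -> mcoeff mone u = 0.
Proof.
have X0 : mcoeff mone (fX k) = 0 by rewrite /fX fgenE mcoeffU fmP fm1 fmuE.
apply: (@jordan_ideal_ker k (mcoeff mone)); rewrite /= X0.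
  by rewrite /rel1 mul0r.
by rewrite /rel2 !(mulr0, mul0r, addr0, subr0).
Qed.

Fact sjp_1_neq0 : sjp_one != 0.
Proof.
apply/eqP; rewrite -(raddf0 pi) => /pi_eq; rewrite subr0.
by move/jordan_ideal_coef1/eqP; rewrite mcoeff1 eqxx oner_eq0.
Qed.

HB.instance Definition _ := GRing.Zmodule_isNzRing.Build B
  sjp_mulA sjp_mul1 sjp_mulr1 sjp_mulDl sjp_mulDr sjp_1_neq0.

Fact sjp_scaleA a b (u : B) : sjp_scale a (sjp_scale b u) = sjp_scale (a * b) u.
Proof. by rewrite -[u]piK !pi_scale scalerA. Qed.

Fact sjp_scale1 : left_id 1 sjp_scale.
Proof. by move=> u; rewrite -[u]piK pi_scale scale1r. Qed.

Fact sjp_scaleDr : right_distributive sjp_scale +%R.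
Proof.
by move=> a u v; rewrite -[u]piK -[v]piK -raddfD !pi_scale -raddfD scalerDr.
Qed.

Fact sjp_scaleDl (u : B) : {morph sjp_scale^~ u : a b / a + b}.
Proof. by move=> a b; rewrite -[u]piK !pi_scale -raddfD scalerDl. Qed.

HB.instance Definition _ := GRing.Zmodule_isLmodule.Build k B
  sjp_scaleA sjp_scale1 sjp_scaleDr sjp_scaleDl.

Fact sjp_scaleAl (c : k) (u v : B) : c *: (u * v) = (c *: u) * v.
Proof.
rewrite -[u]piK -[v]piK.
by rewrite -![_ *: _]/(sjp_scale _ _) -![_ * _]/(sjp_mul _ _)
  !(pi_mul, pi_scale) scalerAl.
Qed.

HB.instance Definition _ := GRing.Lmodule_isLalgebra.Build k B sjp_scaleAl.

Fact sjp_scaleAr (c : k) (u v : B) : c *: (u * v) = u * (c *: v).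
Proof.
rewrite -[u]piK -[v]piK.
by rewrite -![_ *: _]/(sjp_scale _ _) -![_ * _]/(sjp_mul _ _)
  !(pi_mul, pi_scale) scalerAr.
Qed.

HB.instance Definition _ := GRing.Lalgebra_isAlgebra.Build k B sjp_scaleAr.

Fact pi_monoid_morphism : monoid_morphism pi.
Proof. split=> [|u v]; [exact: erefl | exact: esym (pi_mul u v)]. Qed.
HB.instance Definition _ := GRing.isMonoidMorphism.Build F B pi pi_monoid_morphism.

Fact pi_scalable : scalable pi.
Proof. by move=> c u; exact: esym (pi_scale c u). Qed.
HB.instance Definition _ := GRing.isScalable.Build k F B *:%R pi pi_scalable.

Definition sjp_x : B := pi (fX k).
Definition sjp_y : B := pi (fY k).
Definition sjp_z : B := sjp_x * sjp_y + sjp_y * sjp_x.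

End SuperJordanPlane.

Section Lift.
Variables (k : fieldType) (A : algType k) (a b : A).
Local Notation F := (free_alg k).
Local Notation B := (super_jordan_plane k).
Local Notation pi := (@sjp_pi k).

Definition word_eval (m : {fmonom bool}) : A :=
  \prod_(i <- (m : seq bool)) (if i then b else a).

Fact word_eval_mmorphism : mmorphism word_eval.
Proof.
by split=> [m n|]; rewrite /word_eval ?fmM ?big_cat // fm1 big_nil.
Qed.
HB.instance Definition _ :=
  monalg.isMultiplicative.Build _ A word_eval word_eval_mmorphism.

Definition free_lift (u : F) : A := mmap (in_alg A) word_eval u.

Fact free_lift_zmod : zmod_morphism free_lift.
Proof. exact: mmap_is_additive. Qed.
HB.instance Definition _ := GRing.isZmodMorphism.Build F A free_lift free_lift_zmod.

Fact free_lift_monoid : monoid_morphism free_lift.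
Proof.
have [|fM f1] := @commr_mmap_is_multiplicative _ k A (in_alg A) word_eval.
  by move=> g m m'; rewrite /GRing.comm /= mulr_algl mulr_algr.
by split.
Qed.
HB.instance Definition _ := GRing.isMonoidMorphism.Build F A free_lift free_lift_monoid.

Fact free_lift_scalable : scalable free_lift.
Proof. by move=> c u; rewrite /free_lift mmapZ /= mulr_algl. Qed.
HB.instance Definition _ := GRing.isScalable.Build k F A *:%R free_lift free_lift_scalable.

Lemma free_liftX : free_lift (fX k) = a.
Proof.
by rewrite /free_lift [X in mmap _ _ X]fgenE mmapU /= scale1r mul1r /word_eval fmuE big_seq1.
Qed.

Lemma free_liftY : free_lift (fY k) = b.
Proof.
by rewrite /free_lift [X in mmap _ _ X]fgenE mmapU /= scale1r mul1r /word_eval fmuE big_seq1.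
Qed.

Hypotheses (r1 : rel1 a b = 0) (r2 : rel2 a b = 0).

Definition sjp_lift of rel1 a b = 0 & rel2 a b = 0 :=
  fun u : B => free_lift (repr u).
Local Notation lift := (sjp_lift r1 r2).

Lemma sjp_lift_pi u : lift (pi u) = free_lift u.
Proof.
apply/eqP; rewrite -subr_eq0 -(rmorphB free_lift); apply/eqP.
apply: jordan_ideal_ker; rewrite /= ?free_liftX ?free_liftY //.
by apply/pi_eq; exact: piK.
Qed.

Fact sjp_lift_zmod : zmod_morphism lift.
Proof.
by move=> u v; rewrite -[u]piK -[v]piK -raddfB !sjp_lift_pi raddfB.
Qed.
HB.instance Definition _ := GRing.isZmodMorphism.Build B A lift sjp_lift_zmod.

Fact sjp_lift_monoid : monoid_morphism lift.
Proof.
split=> [|u v]; first by rewrite -(rmorph1 pi) sjp_lift_pi rmorph1.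
by rewrite -[u]piK -[v]piK -rmorphM !sjp_lift_pi rmorphM.
Qed.
HB.instance Definition _ := GRing.isMonoidMorphism.Build B A lift sjp_lift_monoid.

Fact sjp_lift_scalable : scalable lift.
Proof.
by move=> c u; rewrite -[u]piK -linearZ !sjp_lift_pi linearZ.
Qed.
HB.instance Definition _ := GRing.isScalable.Build k B A *:%R lift sjp_lift_scalable.

Lemma sjp_lift_x : lift (sjp_x k) = a.
Proof. by rewrite sjp_lift_pi free_liftX. Qed.

Lemma sjp_lift_y : lift (sjp_y k) = b.
Proof. by rewrite sjp_lift_pi free_liftY. Qed.

End Lift.

Section Theory.
Variable k : fieldType.
Local Notation F := (free_alg k).
Local Notation B := (super_jordan_plane k).
Local Notation x := (sjp_x k).
Local Notation y := (sjp_y k).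
Local Notation z := (sjp_z k).

Lemma sjp_rel1 : rel1 x y = 0.
Proof.
rewrite -rmorph_rel1 -(rmorph0 (@sjp_pi k)); apply/pi_eq; rewrite subr0.
exact: JI_rel1.
Qed.

Lemma sjp_rel2 : rel2 x y = 0.
Proof.
rewrite -rmorph_rel2 -(rmorph0 (@sjp_pi k)); apply/pi_eq; rewrite subr0.
exact: JI_rel2.
Qed.

Lemma free_alg_ext (A : algType k) (f g : {lrmorphism F -> A}) :
  f (fX k) = g (fX k) -> f (fY k) = g (fY k) -> f =1 g.
Proof.
move=> eqX eqY u.
have -> : u = \sum_(m <- msupp u) u@_m *: word_eval (fX k) (fY k) m.
  rewrite {1}[u]monalgE; apply: eq_bigr => m _.
  have -> : word_eval (fX k) (fY k) m = << m >>.
    rewrite /word_eval -{2}[m]fmK; elim: {m}(m : seq bool) => [|i s IHs].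
      by rewrite big_nil -fmoneE.
    have -> : FMonom (i :: s) = mmul (fmu i) (FMonom s).
      by rewrite -[RHS]fmK fmM fmuE.
    rewrite big_cons IHs; have -> : << mmul (fmu i) (FMonom s) >>
        = (<< fmu i >> : F) * << FMonom s >>.
      by rewrite malgM_def fgmulUU mulr1.
    by rewrite -fgenE; case: i.
  by rewrite -mul_malgC malgM_def fgmulUU mulr1 mul1m.
rewrite !linear_sum; apply: eq_bigr => m _; rewrite !linearZ /=; congr (_ *: _).
rewrite /word_eval !rmorph_prod; apply: eq_bigr => -[] _ //.
Qed.

Lemma sjp_ext (A : algType k) (f g : {lrmorphism B -> A}) :
  f x = g x -> f y = g y -> f =1 g.
Proof.
move=> eqx eqy u; rewrite -[u]piK.
exact: (@free_alg_ext A (f \o (@sjp_pi k)) (g \o (@sjp_pi k))).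
Qed.

Lemma sjp_xx : x * x = 0.
Proof. by rewrite -[LHS]/(rel1 x y) sjp_rel1. Qed.

Lemma sjp_zx : z * x = x * z.
Proof.
rewrite /sjp_z mulrDl -[y * x * x]mulrA sjp_xx mulr0 addr0.
by rewrite mulrDr [x * (x * y)]mulrA sjp_xx mul0r add0r mulrA.
Qed.

Lemma sjp_commz_horner (b : B) (s : {poly k}) :
  z * b = b * z -> horner_alg z s * b = b * horner_alg z s.
Proof.
move=> zb; elim/poly_ind: s => [|p c IHp]; first by rewrite rmorph0 mul0r mulr0.
rewrite rmorphD rmorphM /= horner_algX horner_algC mulrDl [RHS]mulrDr.
by rewrite -mulrA zb !mulrA IHp mulr_algl mulr_algr.
Qed.

Definition sigma_y (s : {poly k}) : B := y + horner_alg z s * x.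

Lemma sigma_z s : x * sigma_y s + sigma_y s * x = z.
Proof.
rewrite /sigma_y mulrDr [X in _ + X]mulrDl [x * (_ * x)]mulrA.
rewrite -(sjp_commz_horner _ sjp_zx) -![_ * x * x]mulrA sjp_xx mulr0.
by rewrite !addr0.
Qed.

Fact sigma_rel1 s : rel1 x (sigma_y s) = 0.
Proof. exact: sjp_xx. Qed.

Fact sigma_rel2 s : rel2 x (sigma_y s) = 0.
Proof.
rewrite /rel2 sigma_z -sjp_rel2 /rel2 -/z /sigma_y; congr (_ - _).
have -> : (y + horner_alg z s * x) * z = y * z + z * (horner_alg z s * x).
  rewrite mulrDl -mulrA -sjp_zx !mulrA; congr (_ + _ * _).
  exact: sjp_commz_horner.
by rewrite [z * (y + _)]mulrDr opprD addrACA subrr addr0.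
Qed.

(* sigma_{s,1}, where s in k[z] is given as the value at z of a polynomial in *)
(* one indeterminate. [sigma_automorphism] and [sigma_unique] below show that *)
(* it is the only algebra automorphism with x |-> x and y |-> y + s(z) x.     *)
Definition sigma (s : {poly k}) : B -> B := sjp_lift (sigma_rel1 s) (sigma_rel2 s).
HB.instance Definition _ s := GRing.LRMorphism.on (sigma s).

Lemma sigma_x s : sigma s x = x.
Proof. exact: sjp_lift_x. Qed.

Lemma sigma_yE s : sigma s y = y + horner_alg z s * x.
Proof. exact: sjp_lift_y. Qed.

Lemma sigma_horner s p : sigma s (horner_alg z p) = horner_alg z p.
Proof.
have sz : sigma s z = z by rewrite rmorphD !rmorphM /= sigma_x sigma_yE sigma_z.
elim/poly_ind: p => [|p c IHp]; first by rewrite !rmorph0.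
rewrite !rmorphD !rmorphM /= horner_algX horner_algC IHp sz.
by rewrite linearZ /= rmorph1.
Qed.

Lemma sigmaK s : cancel (sigma s) (sigma (- s)).
Proof.
pose f : {lrmorphism B -> B} := sigma (- s) \o sigma s.
pose g : {lrmorphism B -> B} := idfun.
suff fg : f =1 g by move=> u; exact: fg.
apply: sjp_ext; rewrite /f /g /=.
  by rewrite !sigma_x.
rewrite sigma_yE rmorphD rmorphM /= sigma_yE sigma_horner sigma_x.
by rewrite rmorphN mulNr subrK.
Qed.

End Theory.

Section Automorphisms.
Variables (k : fieldType) (A : algType k).

Definition alg_automorphism (f : A -> A) : Prop :=
  bijective f /\ exists g : {lrmorphism A -> A}, f =1 g.

Definition derivation (d : A -> A) : Prop :=
  linear d /\ forall a b, d (a * b) = d a * b + a * d b.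

Definition locally_nilpotent (d : A -> A) : Prop :=
  forall b, exists n, (0 < n)%N && (iter n d b == 0).

(* The sum over all n of d^n(b) / n!, cut at the least n >= 1 such that       *)
(* d^n(b) = 0; by [exp_lndE] any such n gives the same value.                 *)
Definition exp_lnd (d : A -> A) (nil_d : locally_nilpotent d) (b : A) : A :=
  \sum_(n < ex_minn (nil_d b)) (n`!%:R)^-1 *: iter n d b.

Lemma exp_lndE (d : A -> A) (nil_d : locally_nilpotent d) b n :
  d 0 = 0 -> (0 < n)%N -> iter n d b = 0 ->
  exp_lnd nil_d b = \sum_(i < n) (i`!%:R)^-1 *: iter i d b.
Proof.
move=> d0 n0 dn; rewrite /exp_lnd; case: ex_minnP => m /andP[_ /eqP dm] m_min.
have le_mn : (m <= n)%N by rewrite m_min // n0 dn /=.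
rewrite -!(big_mkord xpredT (fun i => (i`!%:R)^-1 *: iter i d b)).
rewrite (big_cat_nat (leq0n m) le_mn) /= [X in _ = _ + X]big_nat.
rewrite [X in _ = _ + X]big1 ?addr0 // => i /andP[le_mi _].
rewrite -(subnK le_mi) iterD dm; elim: (i - m)%N => [|j IHj].
  by rewrite scaler0.
suff -> : iter j.+1 d 0 = 0 by rewrite scaler0.
by elim: j {IHj} => //= j ->.
Qed.

End Automorphisms.

Section GroupN.
Variable k : fieldType.
Local Notation B := (super_jordan_plane k).

Lemma sigma_automorphism s : alg_automorphism (@sigma k s).
Proof.
split; last by exists (sigma s).
by exists (sigma (- s)); [|rewrite -{2}[s]opprK]; exact: sigmaK.
Qed.

Lemma sigma_unique s (f : B -> B) :
    alg_automorphism f -> f (sjp_x k) = sjp_x k ->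
    f (sjp_y k) = sjp_y k + horner_alg (sjp_z k) s * sjp_x k ->
  f =1 sigma s.
Proof.
move=> [_ [g fg]] fx fy u; rewrite fg; apply: sjp_ext.
  by rewrite -fg fx /= sigma_x.
by rewrite -fg fy /= sigma_yE.
Qed.

Definition in_N (f : B -> B) : Prop := exists s : {poly k}, f =1 sigma s.

End GroupN.

(* Main.v *)
From HB Require Import structures.
Require Import Defs.
From mathcomp Require Import all_boot all_order all_algebra.
From mathcomp Require Import monalg.

Import GRing.Theory.
Local Open Scope ring_scope.

(** Write x, y, z for the standard elements of the algebra B.  The automorphism
    sigma_{s,1} sits at t = 1 in the one-parameter family sigma_{ts,1}, and it
    is the exponential of the velocity of this family at t = 0.

    To differentiate in t algebraically, t is taken as a central indeterminate:
    the assignment x |-> x, y |-> y + t s(z) x respects both relations in B[t],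
    hence defines an algebra morphism [flow s] from B to B[t].  Its constant
    coefficient is the identity, so its coefficient of t is a derivation d
    ([velocity]); on generators, d x = 0 and d y = s(z) x.

    The key point is the differential equation (flow b)' = flow (d b)
    ([deriv_flow]).  Both sides are derivations along the
    flow, so comparing them on generators suffices, and there it says only that
    d kills s(z) x.  Comparing coefficients, the equation gives
    d^n b = n! [t^n] (flow b).  As flow b is a polynomial, d is locally
    nilpotent; in characteristic 0 one may divide by n!, and exp d is the value
    of the flow at t = 1 ([exp_flow]), that is, sigma_{s,1}. *)

(** * Polynomials over an algebra, as an algebra over the base field *)

Section PolyAlgebra.
Variables (k : fieldType) (A : algType k).

(** A copy of A[t] with scalars in k: on the type of polynomials itself the
    canonical scalars are the elements of A, whereas the universal property of
    B concerns k-algebras. *)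
Definition poly_alg : Type := {poly A}.

HB.instance Definition _ := GRing.NzRing.on poly_alg.

Definition poly_alg_scale (c : k) (p : poly_alg) : poly_alg :=
  (c%:A : A) *: (p : {poly A}).

Lemma coef_poly_alg_scale c (p : poly_alg) i :
  (poly_alg_scale c p : {poly A})`_i = c *: (p : {poly A})`_i.
Proof. by rewrite coefZ mulr_algl. Qed.

Fact poly_alg_scaleA a b p :
  poly_alg_scale a (poly_alg_scale b p) = poly_alg_scale (a * b) p.
Proof. by apply/polyP => i; rewrite !coef_poly_alg_scale scalerA. Qed.

Fact poly_alg_scale1 : left_id 1 poly_alg_scale.
Proof. by move=> p; apply/polyP => i; rewrite coef_poly_alg_scale scale1r. Qed.

Fact poly_alg_scaleDr : right_distributive poly_alg_scale +%R.
Proof. by move=> a p q; exact: scalerDr. Qed.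

Fact poly_alg_scaleDl p : {morph poly_alg_scale^~ p : a b / a + b}.
Proof. by move=> a b; rewrite /poly_alg_scale !scalerDl. Qed.

HB.instance Definition _ := GRing.Zmodule_isLmodule.Build k poly_alg
  poly_alg_scaleA poly_alg_scale1 poly_alg_scaleDr poly_alg_scaleDl.

Fact poly_alg_scaleAl (c : k) (p q : poly_alg) : c *: (p * q) = (c *: p) * q.
Proof. exact: scalerAl. Qed.

HB.instance Definition _ :=
  GRing.Lmodule_isLalgebra.Build k poly_alg poly_alg_scaleAl.

Fact poly_alg_scaleAr (c : k) (p q : poly_alg) : c *: (p * q) = p * (c *: q).
Proof.
apply/polyP => i; rewrite [LHS]coef_poly_alg_scale [in LHS]coefM [RHS]coefM.
rewrite scaler_sumr; apply: eq_bigr => j _.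
by rewrite coef_poly_alg_scale scalerAr.
Qed.

HB.instance Definition _ :=
  GRing.Lalgebra_isAlgebra.Build k poly_alg poly_alg_scaleAr.

End PolyAlgebra.
Arguments poly_alg {k} A.

(** * Exponentials from polynomial flows *)

Section Flow.
Variables (k : fieldType) (A : algType k).
Variables (Phi : A -> {poly A}) (d : A -> A).
Hypothesis coef0_Phi : forall a, (Phi a)`_0 = a.
Hypothesis deriv_Phi : forall a, (Phi a)^`() = Phi (d a).

(** The Taylor coefficients of a solution of the equation (Phi a)' = Phi (d a)
    are forced by its initial value. *)
Lemma iter_flow n a : iter n d a = (Phi a)`_n *+ n`!.
Proof.
elim: n a => [|n IHn] a; first by rewrite coef0_Phi.
by rewrite iterSr IHn -deriv_Phi coef_deriv -mulrnA factS.
Qed.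

Lemma iter_flow_eq0 n a : (size (Phi a) <= n)%N -> iter n d a = 0.
Proof. by move=> le_n; rewrite iter_flow nth_default // mul0rn. Qed.

Lemma flow_locally_nilpotent : locally_nilpotent d.
Proof. by move=> a; exists (size (Phi a)).+1; rewrite iter_flow_eq0 /=. Qed.

(** Term by term, d^n a / n! is the coefficient of t^n in Phi a. *)
Lemma exp_flow (char0 : [pchar k] =i pred0) (nil_d : locally_nilpotent d) a :
  d 0 = 0 -> exp_lnd nil_d a = (Phi a).[1].
Proof.
move=> d0; have le_n := leqnSn (size (Phi a)).
(* The exponential may be cut at any positive n beyond the degree; the successor
   keeps n positive when Phi a is 0. *)
rewrite (exp_lndE nil_d d0 (ltn0Sn _) (iter_flow_eq0 _ _ le_n)).
rewrite (horner_coef_wide 1 le_n); apply: eq_bigr => i _.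
rewrite expr1n mulr1 iter_flow -scaler_nat scalerA mulVf ?scale1r //.
by rewrite ((pcharf0P k).1 char0) -lt0n fact_gt0.
Qed.

End Flow.

(** * Deforming the relations along a central indeterminate *)

Section Deformation.
Variables (R : nzRingType) (x y w : R).
Local Notation z := (x * y + y * x).
Local Notation yt := (y%:P + 'X * w%:P).
Hypotheses (xw : x * w = 0) (wx : w * x = 0) (zw : z * w = w * z).

Lemma polyC_mulXC (a b : R) : a%:P * ('X * b%:P) = 'X * (a * b)%:P.
Proof. by rewrite mulrA commr_polyX -mulrA polyCM. Qed.

Lemma deriv_deform : yt^`() = w%:P.
Proof. by rewrite derivD derivM derivX !derivC mulr0 addr0 add0r mul1r. Qed.

Lemma horner1_deform : yt.[1] = y + w.
Proof. by rewrite hornerD -commr_polyX hornerMX !hornerC mulr1. Qed.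

Lemma deform_rel1 : rel1 x y = 0 -> rel1 x%:P yt = 0.
Proof. by rewrite /rel1 -polyCM => ->. Qed.

(** The element z is constant along the deformation, because the direction w
    is annihilated by x on both sides. *)
Lemma deform_z : x%:P * yt + yt * x%:P = z%:P.
Proof.
rewrite mulrDr mulrDl polyC_mulXC -['X * _ * _]mulrA -!polyCM xw wx.
by rewrite polyC0 mulr0 !addr0 -polyCD.
Qed.

(** As z is constant, the second relation is affine in t, and its coefficient
    of t is the commutator of w and z. *)
Lemma deform_rel2 : rel2 x y = 0 -> rel2 x%:P yt = 0.
Proof.
rewrite /rel2 /= deform_z => r2.
rewrite mulrDl mulrDr polyC_mulXC -['X * _ * _]mulrA -!polyCM zw.
by rewrite opprD addrACA subrr addr0 -!polyCB r2.
Qed.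

End Deformation.

(** * The flow of sigma on the super Jordan plane *)

Section SuperJordanFlow.
Variable k : fieldType.
Local Notation B := (super_jordan_plane k).
Local Notation x := (sjp_x k).
Local Notation y := (sjp_y k).
Local Notation z := (sjp_z k).

(** Induction on the generation of B by x and y: every element is the class of
    a linear combination of words. *)
Lemma sjp_ind (P : B -> Prop) :
    P x -> P y -> P 1 -> (forall a b, P a -> P b -> P (a + b)) ->
    (forall a b, P a -> P b -> P (a * b)) -> (forall c a, P a -> P (c *: a)) ->
  forall a, P a.
Proof.
move=> Px Py P1 PD PM PZ a; rewrite -[a]piK; move: (repr a) => u.
have Pword m : P (sjp_pi (<< m >> : free_alg k)).
  rewrite -[m]fmK; elim: {m}(m : seq bool) => [|i w Pw].
    by rewrite -fmoneE -[X in P X]/(sjp_pi (1 : free_alg k)) rmorph1.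
  have -> : << FMonom (i :: w) >> = fgen k i * << FMonom w >>.
    have -> : FMonom (i :: w) = mmul (fmu i) (FMonom w).
      by rewrite -[RHS]fmK fmM fmuE.
    by rewrite fgenE malgM_def fgmulUU mulr1.
  by rewrite rmorphM; apply: PM => //; case: i.
rewrite [u]monalgE raddf_sum; elim/big_ind: _ => [|//|m _].
  by rewrite -(scale0r 1); exact: PZ.
have -> : << u@_m *g m >> = u@_m *: (<< m >> : free_alg k).
  by rewrite -mul_malgC malgM_def fgmulUU mulr1 mul1m.
by rewrite /= linearZ; apply: PZ; exact: Pword.
Qed.

Variable s : {poly k}.
Local Notation sx := (horner_alg z s * x).

Definition flow_x : {poly B} := x%:P.
Definition flow_y : {poly B} := y%:P + 'X * sx%:P.

Lemma sx_mulx : sx * x = 0.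
Proof. by rewrite -mulrA sjp_xx mulr0. Qed.

Lemma x_mulsx : x * sx = 0.
Proof. by rewrite mulrA -(sjp_commz_horner _ (sjp_zx k)) sx_mulx. Qed.

Lemma z_mulsx : z * sx = sx * z.
Proof.
by rewrite mulrA -(sjp_commz_horner s (erefl (z * z))) -!mulrA sjp_zx.
Qed.

Fact flow_rel1 : rel1 flow_x flow_y = 0.
Proof. exact: deform_rel1 (sjp_rel1 k). Qed.

Fact flow_rel2 : rel2 flow_x flow_y = 0.
Proof. exact: deform_rel2 x_mulsx sx_mulx z_mulsx (sjp_rel2 k). Qed.

(** The family of morphisms sigma_{ts,1}, with t an indeterminate. *)
Definition flow_morph : B -> poly_alg B :=
  @sjp_lift k (poly_alg B) flow_x flow_y flow_rel1 flow_rel2.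
HB.instance Definition _ := GRing.LRMorphism.on flow_morph.

Fact flow_key : unit. Proof. exact: tt. Qed.

(** Locked, so that unification does not unfold the quotient. *)
Definition flow : B -> {poly B} := locked_with flow_key flow_morph.

Lemma flowE b : flow b = flow_morph b.
Proof. by rewrite /flow unlock. Qed.

Definition velocity (b : B) : B := (flow b)`_1.

Lemma flowx : flow x = x%:P.
Proof.
rewrite flowE.
exact: (@sjp_lift_x k (poly_alg B) flow_x flow_y flow_rel1 flow_rel2).
Qed.

Lemma flowy : flow y = y%:P + 'X * sx%:P.
Proof.
rewrite flowE.
exact: (@sjp_lift_y k (poly_alg B) flow_x flow_y flow_rel1 flow_rel2).
Qed.

Lemma flowZ c b : flow (c *: b) = (c%:A : B) *: flow b.
Proof. by rewrite !flowE linearZ. Qed.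

Lemma coef_flowZ c b i : (flow (c *: b))`_i = c *: (flow b)`_i.
Proof. by rewrite flowZ coefZ mulr_algl. Qed.

Lemma flow0 : flow 0 = 0.
Proof. by rewrite !flowE; exact: (rmorph0 flow_morph). Qed.

Lemma flow1 : flow 1 = 1%:P.
Proof. by rewrite !flowE; exact: (rmorph1 flow_morph). Qed.

Lemma flowD a b : flow (a + b) = flow a + flow b.
Proof. by rewrite !flowE; exact: (rmorphD flow_morph). Qed.

Lemma flowM a b : flow (a * b) = flow a * flow b.
Proof. by rewrite !flowE; exact: (rmorphM flow_morph). Qed.

Lemma flow_scalar c : flow c%:A = (c%:A)%:P.
Proof. by rewrite flowZ flow1 polyC1 alg_polyC. Qed.

Lemma coef0_flow b : (flow b)`_0 = b.
Proof.
move: b; apply: sjp_ind.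
- by rewrite flowx coefC.
- by rewrite flowy coefD coefC coefXM addr0.
- by rewrite flow1 coefC.
- by move=> a b Ha Hb; rewrite flowD coefD Ha Hb.
- by move=> a b Ha Hb; rewrite flowM coef0M Ha Hb.
- by move=> c a Ha; rewrite coef_flowZ Ha.
Qed.

Lemma flow_z : flow z = z%:P.
Proof.
by rewrite flowD !flowM flowx flowy; exact: deform_z x_mulsx sx_mulx.
Qed.

Lemma flow_horner p : flow (horner_alg z p) = (horner_alg z p)%:P.
Proof.
elim/poly_ind: p => [|p c IHp]; first by rewrite (rmorph0 (horner_alg z)) flow0.
rewrite (rmorphD (horner_alg z)) (rmorphM (horner_alg z)) /= horner_algX.
rewrite horner_algC [LHS]flowD [X in X + _]flowM [X in _ + X]flow_scalar.
rewrite [X in X * _]IHp [X in _ * X]flow_z.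
by rewrite [RHS]polyCD [X in _ = X + _]polyCM.
Qed.

Lemma flow_sx : flow sx = sx%:P.
Proof. by rewrite flowM flowx flow_horner polyCM. Qed.

Lemma velocityZ c b : velocity (c *: b) = c *: velocity b.
Proof. exact: coef_flowZ. Qed.

Lemma velocityD a b : velocity (a + b) = velocity a + velocity b.
Proof. by rewrite /velocity flowD coefD. Qed.

(** Leibniz's rule is the product formula for coefficients of t, because the
    flow starts at the identity. *)
Lemma velocityM a b : velocity (a * b) = velocity a * b + a * velocity b.
Proof.
rewrite /velocity flowM coefM !big_ord_recl big_ord0 addr0 /= !coef0_flow.
exact: addrC.
Qed.

Lemma velocity_derivation : derivation velocity.
Proof.
split=> [c a b|]; last exact: velocityM.
by rewrite velocityD velocityZ.
Qed.

Lemma velocity_x : velocity x = 0.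
Proof. by rewrite /velocity flowx coefC. Qed.

Lemma velocity_y : velocity y = sx.
Proof. by rewrite /velocity flowy coefD coefC coefXM coefC add0r. Qed.

Lemma velocity_1 : velocity 1 = 0.
Proof. by rewrite /velocity flow1 coefC. Qed.

(** Infinitesimal form of the group law of the family; on y it uses that the
    velocity s(z) x is constant along the flow. *)
Lemma deriv_flow b : (flow b)^`() = flow (velocity b).
Proof.
move: b; apply: sjp_ind.
- by rewrite velocity_x flowx derivC flow0.
- by rewrite velocity_y flow_sx flowy deriv_deform.
- by rewrite velocity_1 flow1 derivC flow0.
- by move=> a b Ha Hb; rewrite velocityD !flowD derivD Ha Hb.
- by move=> a b Ha Hb; rewrite velocityM flowD !flowM derivM Ha Hb.
- by move=> c a Ha; rewrite velocityZ !flowZ derivZ Ha.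
Qed.

(** Evaluation at t = 1 is multiplicative although B is not commutative,
    because 1 is central. *)
Lemma horner1_flow b : (flow b).[1] = sigma s b.
Proof.
move: b; apply: sjp_ind.
- by rewrite flowx hornerC sigma_x.
- by rewrite flowy horner1_deform sigma_yE.
- by rewrite flow1 hornerC rmorph1.
- by move=> a b Ha Hb; rewrite flowD hornerD Ha Hb rmorphD.
- move=> a b Ha Hb.
  have comm1 : comm_poly (flow b) 1 by rewrite /comm_poly mulr1 mul1r.
  by rewrite flowM (hornerM_comm _ comm1) Ha Hb rmorphM.
- by move=> c a Ha; rewrite linearZ /= -Ha flowZ hornerZ mulr_algl.
Qed.

End SuperJordanFlow.

Theorem proposition6p2 (k : fieldType) (char0 : [pchar k] =i pred0)
    (f : super_jordan_plane k -> super_jordan_plane k) (Nf : in_N f) :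
  exists d : super_jordan_plane k -> super_jordan_plane k,
    derivation d /\
    exists nil_d : locally_nilpotent d, f =1 exp_lnd nil_d.
Proof.
case: Nf => s fs.
exists (velocity _ s); split; first exact: velocity_derivation.
exists (flow_locally_nilpotent _ _ _ _ (coef0_flow _ s) (deriv_flow _ s)) => b.
rewrite (exp_flow _ _ _ _ (coef0_flow _ s) (deriv_flow _ s) char0).
  by rewrite horner1_flow fs.
by rewrite /velocity flow0 coef0.
Qed.
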